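(* The following facet-defining inequality of $\mathrm{BQP}_6$, $$\begin{aligned}&5-4x_1-4x_2+4x_3-5x_4+4x_5-3x_6\\&\quad+3X_{12}-2X_{13}-2X_{23}+5X_{14}+5X_{24}-3X_{34}-2X_{15}-2X_{25}\\&\quad+X_{35}-3X_{45}+2X_{16}+2X_{26}-X_{36}+3X_{46}-X_{56}\ \ge 0,\end{aligned}$$ cannot be represented as an Eigen-CG inequality; that is, there are no $(v_0,v)\in\mathbb{R}\times\mathbb{R}^6$ and $\lambda>0$ such that $\lambda\cdot\mathrm{E\text{-}CG}(v_0,v)$ equals the coefficient vector of this inequality (whose constant term is $5$).
   Context: $\mathrm{BQP}_n=\operatorname{conv}\{(x,X)\in\{0,1\}^{n+\binom n2}: X_{i,j}=x_ix_j,\ 1\le i<j\le n\}$ (Boolean quadric polytope). The paper takes the displayed inequality as a known facet of $\mathrm{BQP}_6$, obtained by exhaustive enumeration; the content of the claim is the non-representability. For $v_0\in\mathbb{R}$, $v\in\mathbb{R}^n$, $\mathrm{E\text{-}CG}(v_0,v)=(\alpha,\beta,\gamma)\in\mathbb{R}^{n+\binom n2+1}$ with $\alpha_i=\lceil v_i^2+2v_iv_0\rceil$ for $i\in\{1,\dots,n\}$, $\beta_{ij}=\lceil 2v_iv_j\rceil$ for $1\le i<j\le n$, $\gamma=\lfloor v_0^2\rfloor$; it is the coefficient vector of the Eigen-CG inequality $\sum_{i<j}\beta_{ij}X_{ij}+\sum_i\alpha_ix_i+\gamma\ge0$. An inequality written in the form $\sum_{i<j}b_{ij}X_{ij}+\sum_ia_ix_i+c\ge0$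 has coefficient vector $(a,b,c)$. *)

(* Defs.v *)
From HB Require Import structures.
From mathcomp Require Import all_boot all_order all_algebra.
From mathcomp Require Import ring reals.

Set Implicit Arguments.
Unset Strict Implicit.
Unset Printing Implicit Defensive.

Import Order.TTheory GRing.Theory Num.Theory.
Local Open Scope ring_scope.

Definition upair (n : nat) : finType := {p : 'I_n * 'I_n | (p.1 < p.2)%N}.

(* R^(n + 'C(n, 2) + 1), as triples (alpha, beta, gamma).  The copies R^o
   equip the product with its componentwise left R-module structure. *)
Definition coefvec (R : realType) (n : nat) : lmodType R :=
  ('rV[R]_n * {ffun upair n -> R^o} * R^o)%type.

(* The affine form of which c is the coefficient vector; the inequality with
   coefficient vector c is 0 <= lhs c x X. *)
Definition lhs (R : realType) (n : nat) (c : coefvec R n)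
    (x : 'rV[R]_n) (X : 'I_n -> 'I_n -> R) : R :=
  \sum_(p : upair n) c.1.2 p * X (val p).1 (val p).2
  + \sum_(i < n) c.1.1 0 i * x 0 i + c.2.

Definition ECG (R : realType) (n : nat) (v0 : R) (v : 'rV[R]_n) :
    coefvec R n :=
  (\row_i (Num.ceil (v 0 i ^+ 2 + 2 * v 0 i * v0))%:~R,
   [ffun p : upair n => (Num.ceil (2 * v 0 (val p).1 * v 0 (val p).2))%:~R],
   (Num.floor (v0 ^+ 2))%:~R).

Definition linear6 : seq int := [:: -4; -4; 4; -5; 4; -3].

(* Entries on and below the diagonal are never read. *)
Definition quadratic6 : seq (seq int) :=
  [:: [:: 0;  3; -2;  5; -2;  2];
      [:: 0;  0; -2;  5; -2;  2];
      [:: 0;  0;  0; -3;  1; -1];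
      [:: 0;  0;  0;  0; -3;  3];
      [:: 0;  0;  0;  0;  0; -1];
      [:: 0;  0;  0;  0;  0;  0]].

Definition coef6 (R : realType) : coefvec R 6 :=
  (\row_i (linear6`_i)%:~R,
   [ffun p : upair 6 => ((nth [::] quadratic6 (val p).1)`_(val p).2)%:~R],
   5).

(* The inequality itself, with the variables numbered from 1. *)
Lemma lhs_coef6 (R : realType) (x : 'rV[R]_6) (X : 'I_6 -> 'I_6 -> R) :
  let x_ (i : nat) := x 0 (inord i.-1) in
  let X_ (i j : nat) := X (inord i.-1) (inord j.-1) in
  lhs (coef6 R) x X =
    5 - 4 * x_ 1%N - 4 * x_ 2%N + 4 * x_ 3%N - 5 * x_ 4%N + 4 * x_ 5%N
    - 3 * x_ 6%N
    + 3 * X_ 1%N 2%N - 2 * X_ 1%N 3%N - 2 * X_ 2%N 3%N + 5 * X_ 1%N 4%N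
    + 5 * X_ 2%N 4%N - 3 * X_ 3%N 4%N - 2 * X_ 1%N 5%N - 2 * X_ 2%N 5%N
    + X_ 3%N 5%N - 3 * X_ 4%N 5%N + 2 * X_ 1%N 6%N + 2 * X_ 2%N 6%N
    - X_ 3%N 6%N + 3 * X_ 4%N 6%N - X_ 5%N 6%N.
Proof.
move=> x_ X_; rewrite /lhs /coef6 /=.
pose F (i j : 'I_6) : R := ((nth [::] quadratic6 i)`_j)%:~R * X i j.
have -> : \sum_(p : upair 6)
    [ffun q : upair 6 => ((nth [::] quadratic6 (val q).1)`_(val q).2)%:~R] p
       * X (val p).1 (val p).2
    = \sum_(i < 6) \sum_(j < 6 | (i < j)%N) F i j.
  rewrite pair_big_dep /= (reindex_omap (val : upair 6 -> _) insub) /=.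
    apply: eq_big => [p|p _]; last by rewrite ffunE.
    by rewrite (valP p) valK eqxx.
  by move=> p pP; rewrite insubT.
have -> : \sum_(i < 6) (\row_i (linear6`_i)%:~R) 0 i * x 0 i
    = \sum_(i < 6) (linear6`_i)%:~R * x_ i.+1.
  by apply: eq_bigr => i _; rewrite mxE /x_ inord_val.
have -> : \sum_(i < 6) \sum_(j < 6 | (i < j)%N) F i j
    = \sum_(i < 6) \sum_(j < 6 | (i < j)%N)
        ((nth [::] quadratic6 i)`_j)%:~R * X_ i.+1 j.+1.
  apply: eq_bigr => i _; apply: eq_bigr => j _.
  by rewrite /F /X_ !inord_val.
under eq_bigr => i _ do rewrite big_mkcond /=.
rewrite !big_ord_recl !big_ord0 /=.
rewrite /bump /= !add1n; clearbody x_ X_; ring.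
Qed.

(* Main.v *)
Require Import Defs.
From mathcomp Require Import all_boot all_order all_algebra.
From mathcomp Require Import ring lra reals.

Import Order.TTheory GRing.Theory Num.Theory.
Local Open Scope ring_scope.

(** The quadratic coefficients of an Eigen-CG inequality round up the entries
    of the rank-one matrix [2 * v i * v j], and four of them already conflict
    with rank one.  Put [t i j = lambda * (2 * v i * v j)], so that
    [t 1 3 * t 2 5 = t 1 2 * t 3 5].  Rounding up only increases, so [t i j] is
    at most the prescribed coefficient of [X i j].  The coefficients -2 and -2
    of [X 1 3] and [X 2 5] make the left-hand side at least 4.  The coefficients
    3 and 1 of [X 1 2] and [X 3 5] bound the right-hand side by 3, once
    [t 1 2 > 0], which holds because a number whose ceiling is positive is
    itself positive.  (The proof numbers the variables from 0.) *)

Lemma scaled_ceil_ub (R : realType) (lambda t b : R) :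
  0 < lambda -> lambda * (Num.ceil t)%:~R = b -> lambda * t <= b.
Proof. by move=> l0 <-; rewrite ler_pM2l // ceil_ge. Qed.

Lemma scaled_ceil_gt0 (R : realType) (lambda t b : R) :
  0 < lambda -> 0 < b -> lambda * (Num.ceil t)%:~R = b -> 0 < lambda * t.
Proof.
by move=> l0 b0 E; move: b0; rewrite -E !pmulr_rgt0 // ltr0z ceil_gt0.
Qed.

Lemma scaled_ECG_quadratic (R : realType) (n : nat) (v0 lambda : R)
    (v : 'rV[R]_n) (c : coefvec R n) (i j : 'I_n) (ltij : (i < j)%N) :
  lambda *: ECG v0 v = c ->
  lambda * (Num.ceil (2 * v 0 i * v 0 j))%:~R
    = c.1.2 (Sub (i, j) ltij : upair n).
Proof. by move=> <-; rewrite /= !ffunE. Qed.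

Theorem proposition4 (R : realType) :
  ~ exists (v0 : R) (v : 'rV[R]_6) (lambda : R),
      0 < lambda /\ lambda *: ECG v0 v = coef6 R.
Proof.
move=> [v0 [v [l [l0 E]]]].
have H (i j : 'I_6) (ltij : (i < j)%N) :
    l * (Num.ceil (2 * v 0 i * v 0 j))%:~R
      = ((nth [::] quadratic6 i)`_j)%:~R.
  by rewrite (scaled_ECG_quadratic _ _ _ _ _ _ _ _ ltij E) ffunE.
pose k m (ltm6 : (m < 6)%N) := Ordinal ltm6.
have H01 := H (k 0%N isT) (k 1%N isT) isT.
have H02 := H (k 0%N isT) (k 2%N isT) isT.
have H14 := H (k 1%N isT) (k 4%N isT) isT.
have H24 := H (k 2%N isT) (k 4%N isT) isT.
have p01 := scaled_ceil_gt0 _ _ _ _ l0 (ltr0Sn R 2) H01.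
move: (scaled_ceil_ub _ _ _ _ l0 H01) (scaled_ceil_ub _ _ _ _ l0 H02)
  (scaled_ceil_ub _ _ _ _ l0 H14) (scaled_ceil_ub _ _ _ _ l0 H24) p01 => /=.
move: (v 0 (k 0%N isT)) (v 0 (k 1%N isT)) (v 0 (k 2%N isT)) (v 0 (k 4%N isT)).
move=> a b c d u01 u02 u14 u24 p01.
have rank1 : (l * (2 * a * c)) * (l * (2 * b * d))
           = (l * (2 * a * b)) * (l * (2 * c * d)) by ring.
move: rank1 u01 u02 u14 u24 p01.
move: (l * (2 * a * c)) (l * (2 * b * d)) (l * (2 * a * b)) (l * (2 * c * d)).
by move=> x y z w rank1 uz ux uy uw z0; nra.
Qed.
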